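(* Let $q$ be an odd prime power and let $n$ be a positive integer. Let $R$ be a commutative finite chain ring with residue field $\mathbb{F}_q$ and nilpotency index $e$. Let $a\in U(R)$. Then $$|ST_n(R,a)|=\begin{cases}\dfrac{|IST_n(R)|+S_n(R)}{(q-1)q^{e-1}} & \text{if } a\in Q(R),\\[10pt] \dfrac{|IST_n(R)|-S_n(R)}{(q-1)q^{e-1}} & \text{if } a\notin Q(R).\end{cases}$$ In particular, if $n$ is odd, then $S_n(R)=0$ and $$|ST_n(R,a)|=\dfrac{|IST_n(R)|}{(q-1)q^{e-1}}$$ for all $a\in U(R)$.
   Context: A commutative finite chain ring is a finite commutative ring $R$ with identity $1\ne 0$ whose ideals are totally ordered under inclusion. It has a unique maximal ideal, which is principal, say generated by $\gamma$; the nilpotency index $e$ of $R$ is the least positive integer with $\gamma^e=0$, and the residue field is $R/\gamma R\cong\mathbb{F}_q$, a finite field with $q$ elements. $U(R)$ is the group of units of $R$ and $Q(R)=\{a\in U(R): a=x^2\text{ for some }x\in R\}$. For $n\ge 1$, $ST_n(R)$ is the set of $n\times n$ symmetric tridiagonal matrices over $R$, i.e. symmetric matrices whose entries outside the main diagonal, the subdiagonal and the superdiagonal are zero. $ST_n(R,a)=\{A\in ST_n(R):\det(A)=a\}$ and $IST_n(R)=\{A\in ST_n(R):\det(A)\in U(R)\}$. Let $\psi:R\to R/\gamma R\cong\mathbb{F}_q$ be the reduction map, $\chi$ the quadratic character of $\mathbb{F}_q$ ($\chi(0)=0$, $\chi(c)=1$ if $c$ is a nonzero square, $\chi(c)=-1$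 if $c$ is a nonsquare), and $\eta_R=\chi\circ\psi$. Then $S_n(R)=\sum_{a\in U(R)}\eta_R(a)\,|ST_n(R,a)|$. *)

(* Defs.v *)
From HB Require Import structures.
From mathcomp Require Export all_boot all_order all_algebra.

Set Implicit Arguments.
Unset Strict Implicit.
Unset Printing Implicit Defensive.

Import GRing.Theory.
Local Open Scope ring_scope.

Section Ideals.
Variable R : finComUnitRingType.

(* Unlike the library's idealr_closed, this does not exclude the ideal R. *)
Definition ideal (I : {set R}) : Prop :=
  [/\ 0 \in I,
      forall u v, u \in I -> v \in I -> u + v \in I
    & forall a u, u \in I -> a * u \in I].

Definition chain_ring : Prop :=
  forall I J : {set R}, ideal I -> ideal J -> I \subset J \/ J \subset I.

Definition maximal_ideal (I : {set R}) : Prop :=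
  [/\ ideal I, I != [set: R]
    & forall J : {set R}, ideal J -> I \subset J -> J = I \/ J = [set: R]].

Definition principal_ideal (g : R) : {set R} := [set a * g | a in [set: R]].

Definition nilpotency_index (g : R) (e : nat) : Prop :=
  [/\ (0 < e)%N, g ^+ e = 0
    & forall k : nat, (0 < k)%N -> g ^+ k = 0 -> (e <= k)%N].

(* By the first isomorphism theorem, such a psi is the same thing as the
   canonical projection R -> R / gR followed by an isomorphism R / gR -> F. *)
Definition residue_map (g : R) (F : finFieldType) (psi : {rmorphism R -> F}) :
    Prop :=
  (forall y : F, exists x : R, psi x = y) /\
  (forall x : R, psi x = 0 <-> x \in principal_ideal g).

Definition U_ : {set R} := [set a | a \is a GRing.unit].

Definition Q_ : {set R} := [set a in U_ | [exists x : R, a == x ^+ 2]].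

End Ideals.

Definition quadratic_char (F : finFieldType) (c : F) : int :=
  if c == 0 then 0 else if [exists x : F, c == x ^+ 2] then 1 else -1.

Section SymmetricTridiagonal.
Variables (R : finComUnitRingType) (n : nat).

Definition tridiagonal (A : 'M[R]_n) : bool :=
  [forall i : 'I_n, forall j : 'I_n,
     (i.+1 < j)%N || (j.+1 < i)%N ==> (A i j == 0)].

Definition ST : {set 'M[R]_n} := [set A | (A^T == A) && tridiagonal A].

Definition ST_det (a : R) : {set 'M[R]_n} := [set A in ST | \det A == a].

Definition IST : {set 'M[R]_n} := [set A in ST | \det A \in U_ R].

Definition S_ (F : finFieldType) (psi : {rmorphism R -> F}) : int :=
  \sum_(a in U_ R) quadratic_char (psi a) * (#|ST_det a|)%:Z.

End SymmetricTridiagonal.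

Arguments U_ : clear implicits.
Arguments Q_ : clear implicits.
Arguments ST : clear implicits.
Arguments ST_det : clear implicits.
Arguments IST : clear implicits.
Arguments S_ R n {F} psi.

(* Main.v *)
(** Rescaling the first row and column of a matrix by a unit [u] preserves
    symmetric tridiagonality and multiplies the determinant by [u ^+ 2], so
    [|ST_n(R, a)|] depends only on the class of [a] modulo unit squares.  Since
    [2] is invertible, squaring is two-to-one on the units, so there are exactly
    two classes, of size [|U(R)| / 2]; by Hensel's lemma they are separated by
    the quadratic character of the residue.  Hence [|IST_n| + S_n] and
    [|IST_n| - S_n] count twice the matrices whose determinant lies in one class.
    For odd [n], multiplying a matrix by a nonsquare unit exchanges the two
    classes. *)

Require Import Defs.
From mathcomp Require Import all_boot all_order all_algebra finfield ring.

Set Implicit Arguments.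
Unset Strict Implicit.
Unset Printing Implicit Defensive.

Import GRing.Theory.
Local Open Scope ring_scope.

(** * Units and ideal sizes, read off from the residue field *)

Lemma principal_idealP (R : finComUnitRingType) (g x : R) :
  reflect (exists y, x = y * g) (x \in principal_ideal g).
Proof.
by apply: (iffP imsetP) => [[y _ ->]|[y ->]]; exists y.
Qed.

(** The inverse is the finite geometric sum from factoring [1 - z ^+ m]. *)
Lemma nilpotent_unit_1B (R : comUnitRingType) (z : R) (m : nat) :
  z ^+ m = 0 -> 1 - z \is a GRing.unit.
Proof.
move=> zm0; have := subrXX_comm m (commr1 z).
rewrite zm0 expr1n sub0r => zE; apply/unitrPr.
exists (\sum_(i < m) z ^+ (m.-1 - i) * 1 ^+ i).
by rewrite -[1 - z]opprB mulNr -zE opprK.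
Qed.

Section ResidueField.

Variables (R : finComUnitRingType) (gamma : R) (e : nat).
Hypothesis he : nilpotency_index gamma e.
Variables (F : finFieldType) (psi : {rmorphism R -> F}).
Hypothesis hpsi : residue_map gamma psi.

(** The sigma type lets [sval] provide a set-theoretic section of [psi]. *)
Lemma residue_lift (y : F) : {x : R | psi x = y}.
Proof.
have /existsP/sigW[x /eqP xy] : [exists x, psi x == y].
  by have [x xy] := hpsi.1 y; apply/existsP; exists x; rewrite xy.
by exists x.
Qed.

Lemma residue_ker (x : R) : psi x = 0 -> exists y, x = y * gamma.
Proof. by move=> /(hpsi.2 x)/principal_idealP. Qed.

Lemma residue_gamma : psi gamma = 0.
Proof. by apply/hpsi.2/principal_idealP; exists 1; rewrite mul1r. Qed.

(** If [y] lifts the inverse of [psi x], then [1 - x * y] is a multiple of [gamma], hence nilpotent,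
    so [x * y] is a unit. *)
Lemma residue_unitE (x : R) : (x \is a GRing.unit) = (psi x != 0).
Proof.
apply/idP/idP => [ux|nx]; first by rewrite -unitfE rmorph_unit.
have [_ ge0 _] := he; have [y yE] := residue_lift (psi x)^-1.
have [|z zE] := @residue_ker (1 - x * y).
  by rewrite rmorphB rmorphM rmorph1 /= yE divff // subrr.
have := @nilpotent_unit_1B _ (1 - x * y) e.
rewrite zE exprMn ge0 mulr0 -zE opprB addrC subrK unitrM.
by move=> /(_ erefl)/andP[].
Qed.

(** With [s] a section of [psi], each element of the larger ideal is uniquely [s c * gamma ^+ i + w]
    with [c] in [F] and [w] in the smaller ideal. *)
Lemma card_principal_ideal_expr (i : nat) : (i < e)%N ->
  #|principal_ideal (gamma ^+ i)| =
    (#|F| * #|principal_ideal (gamma ^+ i.+1)|)%N.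
Proof.
move=> lt_ie; pose s c := sval (residue_lift c).
have sK c : psi (s c) = c by rewrite /s; case: residue_lift.
pose f (w : F * R) := s w.1 * gamma ^+ i + w.2.
pose D := setX [set: F] (principal_ideal (gamma ^+ i.+1)).
rewrite -cardsT -cardsX -/D -(@card_in_imset _ _ f D).
  congr #|pred_of_set _|; apply/setP => x.
  apply/principal_idealP/imsetP => [[y ->]|[[c z]]].
    have [|t tE] := @residue_ker (y - s (psi y)).
      by rewrite rmorphB /= sK subrr.
    exists (psi y, (y - s (psi y)) * gamma ^+ i); last by rewrite /f /=; ring.
    rewrite !inE; apply/principal_idealP; exists t.
    by rewrite tE exprS mulrA.
  rewrite !inE /= => /principal_idealP[t ->] ->.
  by exists (s c + t * gamma); rewrite /f /= exprS; ring.
move=> [c y] [c' y']; rewrite !inE /=.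
move=> /principal_idealP[t ->] /principal_idealP[t' ->]; rewrite /f /= => E.
have [cc'|ncc'] := eqVneq c c'.
  by rewrite cc' in E *; rewrite (addrI _ E).
(* Otherwise [gamma ^+ i] would be annihilated by a unit. *)
pose v := s c - s c' + (t - t') * gamma.
have uv : v \is a GRing.unit.
  rewrite residue_unitE rmorphD rmorphB rmorphM /= !sK residue_gamma mulr0 addr0.
  by rewrite subr_eq0.
have v0 : v * gamma ^+ i = 0.
  apply/eqP; rewrite -(subrr (s c' * gamma ^+ i + t' * gamma ^+ i.+1)) -{1}E.
  by apply/eqP; rewrite /v exprS; ring.
have gi0 : gamma ^+ i = 0 by apply: (mulrI uv); rewrite v0 mulr0.
(* Minimality of [e] only concerns positive exponents, so [i = 0] is excluded by [1 != 0]
   instead. *)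
case: i lt_ie gi0 {v0 E f D} => [|i] lt_ie gi0.
  by move/eqP: gi0; rewrite expr0 oner_eq0.
by have [_ _ /(_ i.+1 isT gi0)] := he; rewrite leqNgt lt_ie.
Qed.

(** Induction upwards from the zero ideal; [k = e] gives the size of [R] and [k = e - 1] that of the
    maximal ideal. *)
Lemma card_principal_ideal_expr_sub (k : nat) : (k <= e)%N ->
  #|principal_ideal (gamma ^+ (e - k))| = (#|F| ^ k)%N.
Proof.
have [e_gt0 ge0 _] := he; elim: k => [_|k IHk lt_ke].
  rewrite subn0 ge0 expn0; apply/eqP/cards1P; exists 0; apply/setP => x.
  rewrite inE; apply/principal_idealP/eqP => [[y ->]|->]; first exact: mulr0.
  by exists 0; rewrite mulr0.
rewrite card_principal_ideal_expr ?ltn_subrL //.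
by rewrite -subSn // subSS IHk ?expnS // ltnW.
Qed.

Lemma card_units : #|U_ R| = ((#|F| - 1) * #|F| ^ (e - 1))%N.
Proof.
have -> : U_ R = ~: principal_ideal gamma.
  apply/setP => x; rewrite !inE residue_unitE; congr negb.
  by apply/eqP/idP => /hpsi.2.
have [e_gt0 _ _] := he.
have := card_principal_ideal_expr_sub (leqnn e).
rewrite subnn expr0 => cardR.
have := @card_principal_ideal_expr_sub (e - 1) (leq_subr _ _).
rewrite subKn // expr1 => cardG.
rewrite cardsCs setCK cardG mulnBl mul1n -expnS subn1 prednK // -cardR.
congr (_ - _)%N; rewrite -cardsT; congr #|pred_of_set _|; apply/setP => x.
by rewrite inE; apply/esym/principal_idealP; exists x; rewrite mulr1.
Qed.

(** * Squares of units *)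

Hypothesis two_neq0 : 2%:R != 0 :> F.

(** In [(x - y) * (x + y) = 0] a unit factor kills the other one; if neither is a unit, both
    residues vanish and so does [2 * psi x]. *)
Lemma unit_sqr_eq (x y : R) : x \is a GRing.unit -> x ^+ 2 = y ^+ 2 ->
  x = y \/ x = - y.
Proof.
move=> ux /eqP; rewrite -subr_eq0 subr_sqr => /eqP E.
have [u|nu] := boolP (x - y \is a GRing.unit).
  by right; apply/eqP; rewrite -addr_eq0; apply/eqP/(mulrI u); rewrite E mulr0.
have [u|nu'] := boolP (x + y \is a GRing.unit).
  by left; apply/eqP; rewrite -subr_eq0; apply/eqP/(mulIr u); rewrite E mul0r.
move: nu nu' ux; rewrite !residue_unitE !negbK rmorphB rmorphD /=.
move=> /eqP h1 /eqP h2; case/negP.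
have : 2%:R * psi x == 0.
  by apply/eqP; rewrite -(addr0 0) -{1}h1 -h2; ring.
by rewrite mulf_eq0 (negPf two_neq0).
Qed.

(* Hensel's lemma for [X ^+ 2 - a]. *)
Lemma unit_squareP (a : R) : a \is a GRing.unit ->
  (a \in Q_ R) = [exists c : F, psi a == c ^+ 2].
Proof.
move=> ua; rewrite !inE ua /=; apply/existsP/existsP => [[x /eqP ->]|[c /eqP ac]].
  by exists (psi x); rewrite rmorphXn.
(* Square roots modulo every power of [gamma] suffice, since [gamma ^+ e.+1 = 0]. *)
suff /(_ e) [x [y]] : forall k, exists x y, a - x ^+ 2 = y * gamma ^+ k.+1.
  have [_ ge0 _] := he; rewrite [gamma ^+ _]exprSr ge0 mul0r mulr0.
  move=> /eqP; rewrite subr_eq0.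
  by exists x.
elim=> [|k [x [y axy]]].
  have [x xc] := residue_lift c.
  have [|y yE] := @residue_ker (a - x ^+ 2).
    by rewrite rmorphB rmorphXn /= xc ac subrr.
  by exists x, y.
have u2x : 2%:R * x \is a GRing.unit.
  have /eqP := congr1 psi axy.
  rewrite rmorphB rmorphM !rmorphXn /= residue_gamma expr0n mulr0 subr_eq0.
  move=> /eqP psiaE; move: ua; rewrite !residue_unitE psiaE rmorphM rmorph_nat.
  by rewrite sqrf_eq0 mulf_eq0 (negPf two_neq0).
(* Newton step: [2 * x * s = y] cancels the error [y * gamma ^+ k.+1], leaving only the quadratic
   term, divisible by [gamma ^+ k.+2]. *)
pose s := y / (2%:R * x).
exists (x + s * gamma ^+ k.+1), (- s ^+ 2 * gamma ^+ k).
have sE : 2%:R * x * s = y by rewrite mulrC divrK.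
transitivity (a - x ^+ 2 - 2%:R * x * s * gamma ^+ k.+1
               - s ^+ 2 * (gamma ^+ k.+1 * gamma ^+ k.+1)); first by ring.
by rewrite axy sE !exprS; ring.
Qed.

Lemma quadratic_char_residue (a : R) : a \is a GRing.unit ->
  quadratic_char (psi a) = if a \in Q_ R then 1 else -1.
Proof.
move=> ua; rewrite /quadratic_char unit_squareP //.
by move: ua; rewrite residue_unitE => /negPf ->.
Qed.

(** Each fibre of squaring over a unit square is a pair [b], [- b]. *)
Lemma card_units_squares : #|U_ R| = (2 * #|Q_ R|)%N.
Proof.
rewrite -sum1_card (partition_big (fun x => x ^+ 2) [in Q_ R]) /=; last first.
  move=> x; rewrite !inE => ux; rewrite unitrX //=.
  by apply/existsP; exists x.
rewrite mulnC -sum_nat_const; apply: eq_bigr => a.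
rewrite !inE => /andP[ua /existsP[b /eqP aE]].
have ub : b \is a GRing.unit by move: ua; rewrite aE unitrX_pos.
(* The fibre size 2 is rewritten as [(b != - b).+1], the form in which [cards2] gives it. *)
rewrite sum1dep_card -[RHS]/(true.+1).
have <- : b != - b.
  apply/eqP => bN; move: (ub); rewrite residue_unitE => /negP[].
  have : 2%:R * psi b == 0.
    by rewrite mulr_natl mulr2n {2}bN rmorphN /= subrr.
  by rewrite mulf_eq0 (negPf two_neq0).
rewrite -cards2; congr #|pred_of_set _|; apply/setP => x.
rewrite !inE aE; apply/andP/orP => [[ux /eqP xb]|].
  by case: (unit_sqr_eq ux xb) => ->; rewrite eqxx; [left|right].
by case=> /eqP ->; rewrite ?unitrN ?sqrrN.
Qed.

Lemma square_notin (u a : R) : u \in U_ R -> u \notin Q_ R ->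
  a \in Q_ R -> u * a \in U_ R :\: Q_ R.
Proof.
rewrite !inE => uu; rewrite uu /= => nu /andP[ua /existsP[x /eqP aE]].
rewrite unitrM uu ua /= andbT; apply: contra nu => /existsP[y /eqP yE].
have ux : x ^+ 2 \is a GRing.unit by rewrite -aE.
apply/existsP; exists (y / x); apply/eqP/(mulIr ux).
by rewrite -{1}aE yE expr_div_n divrK //.
Qed.

(* The squares have index 2, so a coset of a nonsquare is everything else. *)
Lemma nonsquare_coset (u : R) : u \in U_ R -> u \notin Q_ R ->
  [set u * a | a in Q_ R] = U_ R :\: Q_ R.
Proof.
move=> uu nu; apply/eqP; rewrite eqEcard; apply/andP; split.
  by apply/subsetP => _ /imsetP[a aQ ->]; apply: square_notin.
have QU : Q_ R \subset U_ R by apply/subsetP => x; rewrite inE => /andP[].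
rewrite card_imset; last by apply: mulrI; move: uu; rewrite inE.
by rewrite cardsDS // card_units_squares mul2n -addnn addnK.
Qed.

(** For squares, take the quotient of two roots; for nonsquares, [b] lies in the coset of [a] by the
    squares. *)
Lemma same_square_class (a b : R) : a \in U_ R -> b \in U_ R ->
  (a \in Q_ R) = (b \in Q_ R) -> exists2 u, u \is a GRing.unit & b = u ^+ 2 * a.
Proof.
move=> aU bU; have [aQ bQ|naQ nbQ] := boolP (a \in Q_ R).
  move: aQ (esym bQ); rewrite !inE => /andP[ua /existsP[x /eqP aE]].
  move=> /andP[ub /existsP[y /eqP bE]].
  have ux : x \is a GRing.unit by move: ua; rewrite aE unitrX_pos.
  have uy : y \is a GRing.unit by move: ub; rewrite bE unitrX_pos.
  exists (y / x); first by rewrite unitrM uy unitrV.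
  by rewrite expr_div_n // -aE divrK.
have : b \in U_ R :\: Q_ R by rewrite inE bU -nbQ.
rewrite -(nonsquare_coset aU naQ) => /imsetP[c cQ bE].
move: cQ; rewrite !inE => /andP[uc /existsP[x /eqP cE]].
exists x; first by move: uc; rewrite cE unitrX_pos.
by rewrite bE cE mulrC.
Qed.

Lemma exists_nonsquare : exists2 u : R, u \in U_ R & u \notin Q_ R.
Proof.
have QU : Q_ R \subset U_ R by apply/subsetP => x; rewrite inE => /andP[].
have Q_gt0 : (0 < #|Q_ R|)%N.
  apply/card_gt0P; exists 1; rewrite !inE unitr1.
  by apply/existsP; exists 1; rewrite expr1n.
have /card_gt0P[u] : (0 < #|U_ R :\: Q_ R|)%N.
  by rewrite cardsDS // card_units_squares mul2n -addnn addnK.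
by rewrite inE => /andP[nu uu]; exists u.
Qed.

End ResidueField.

(** * Invariance of the matrix counts under rescaling *)

Section Rescaling.

Variables (R : finComUnitRingType) (n : nat).

Lemma STP (A : 'M[R]_n) :
  reflect ((forall i j, A i j = A j i) /\
           (forall i j : 'I_n, (i.+1 < j)%N || (j.+1 < i)%N -> A i j = 0))
          (A \in ST R n).
Proof.
rewrite inE; apply: (iffP andP) => [[/eqP sA /forallP tA]|[sA tA]]; split.
- by move=> i j; rewrite -{1}sA mxE.
- by move=> i j ij; have /forallP/(_ j)/implyP/(_ ij)/eqP := tA i.
- by apply/eqP/matrixP => i j; rewrite mxE.
- by do 2!apply/forallP => ?; apply/implyP => /tA ->.
Qed.

(** One injection gives only an inequality; applying it to a unit and to its inverse will give
    equality. *)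
Lemma card_ST_det_map (f : 'M[R]_n -> 'M[R]_n) (a b : R) :
    injective f -> {homo f : A / A \in ST R n} ->
    (forall A, \det A = a -> \det (f A) = b) ->
  (#|ST_det R n a| <= #|ST_det R n b|)%N.
Proof.
move=> f_inj fST fdet; rewrite -(card_imset _ f_inj); apply/subset_leq_card.
apply/subsetP => _ /imsetP[A /setIdP[AST /eqP/fdet detA] ->].
by rewrite inE fST //= detA.
Qed.

Lemma card_ST_det_scale (u a : R) : u \is a GRing.unit ->
  #|ST_det R n (u ^+ n * a)| = #|ST_det R n a|.
Proof.
have le (b v : R) : v \is a GRing.unit ->
    (#|ST_det R n b| <= #|ST_det R n (v ^+ n * b)%R|)%N.
  move=> uv; apply: (@card_ST_det_map (fun A => v *: A)).
  - by apply: (can_inj (g := *:%R v^-1)) => A; rewrite scalerA mulVr ?scale1r.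
  - move=> A /STP[sA tA]; apply/STP; split=> i j; rewrite !mxE.
      by rewrite sA.
    by move=> /tA ->; rewrite mulr0.
  - by move=> A detA; rewrite detZ detA.
move=> uu; apply/eqP; rewrite eqn_leq le // andbT.
rewrite -{2}[a](@mulKr _ (u ^+ n)) ?unitrX // -exprVn.
by apply: le; rewrite unitrV.
Qed.

Lemma card_ST_det_sqr (u a : R) : (0 < n)%N -> u \is a GRing.unit ->
  #|ST_det R n (u ^+ 2 * a)| = #|ST_det R n a|.
Proof.
move=> n_gt0.
have le (b v : R) : v \is a GRing.unit ->
    (#|ST_det R n b| <= #|ST_det R n (v ^+ 2 * b)%R|)%N.
  (* Congruence by [diag(v, 1, ..., 1)], of determinant [v], multiplies entry [(i, j)] by
     [d_i * d_j], so symmetry and zeros survive. *)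
  move=> uv; pose d : 'rV[R]_n := \row_j (if val j == 0%N then v else 1).
  have detd : \det (diag_mx d) = v.
    rewrite det_diag (bigD1 (Ordinal n_gt0)) //= mxE /= big1 ?mulr1 //.
    by move=> j; rewrite -val_eqE mxE /= => /negPf ->.
  have ud : diag_mx d \in unitmx by rewrite unitmxE detd.
  apply: (@card_ST_det_map (fun A => diag_mx d *m A *m diag_mx d)).
  - by move=> A B /(can_inj (mulmxK ud))/(can_inj (mulKmx ud)).
  - move=> A /STP[sA tA]; apply/STP; split=> i j.
      by rewrite mul_diag_mx mul_mx_diag !mxE sA; ring.
    by move=> /tA Aij; rewrite mul_diag_mx mul_mx_diag !mxE Aij mulr0 mul0r.
  - by move=> A detA; rewrite !det_mulmx detd detA; ring.
move=> uu; apply/eqP; rewrite eqn_leq le // andbT.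
rewrite -{2}[a](@mulKr _ (u ^+ 2)) ?unitrX // -exprVn.
by apply: le; rewrite unitrV.
Qed.

Lemma card_IST : #|IST R n| = (\sum_(a in U_ R) #|ST_det R n a|)%N.
Proof.
rewrite -sum1_card (partition_big (fun A : 'M[R]_n => \det A) [in U_ R]) /=.
  apply: eq_bigr => a aU; rewrite sum1dep_card; apply: eq_card => A.
  rewrite !inE -!andbA; case: (_ == a) / eqP => [->|_]; rewrite ?andbF //.
  by move: aU; rewrite inE => ->.
by move=> A /setIdP[].
Qed.

End Rescaling.

(** If 2 vanished, [p] would be 2 and the field size a positive power of 2. *)
Lemma odd_card_two_neq0 (F : finFieldType) (p k : nat) :
  prime p -> #|F| = (p ^ k)%N -> odd #|F| -> 2%:R != 0 :> F.
Proof.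
move=> p_pr cardF; apply: contraL => two0.
have pF := card_finPcharP cardF p_pr.
have F2 : 2%N \in [pchar F] by rewrite inE.
have /eqP p2 : 2%N == p by move: F2; rewrite (pcharf_eq pF).
have k_gt0 : (0 < k)%N.
  by case: k cardF => // cardF; have := finNzRing_gt1 F; rewrite cardF.
by rewrite cardF -p2 oddX negb_or -lt0n k_gt0.
Qed.

(** * From square classes to the counting formula *)

Section Counting.

Variables (n : nat) (R : finComUnitRingType) (gamma : R) (e : nat).
Hypothesis n_gt0 : (0 < n)%N.
Hypothesis he : nilpotency_index gamma e.
Variables (F : finFieldType) (psi : {rmorphism R -> F}).
Hypothesis hpsi : residue_map gamma psi.
Hypothesis two_neq0 : 2%:R != 0 :> F.

Lemma card_ST_det_class (a b : R) : a \in U_ R -> b \in U_ R ->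
  (a \in Q_ R) = (b \in Q_ R) -> #|ST_det R n a| = #|ST_det R n b|.
Proof.
move=> aU bU ab; have [u uu ->] := same_square_class he hpsi two_neq0 aU bU ab.
by rewrite card_ST_det_sqr.
Qed.

(** On the right, the count for [b] has weight 1 plus or minus its character: 2 on the square class
    of [a], 0 off it. On the left, that class has half of the units and a constant count. *)
Lemma card_ST_det_formula (a : R) : a \in U_ R ->
  (#|ST_det R n a| * #|U_ R|)%N%:Z =
    #|IST R n|%:Z + (if a \in Q_ R then S_ R n psi else - S_ R n psi).
Proof.
move=> aU; have QU : Q_ R \subset U_ R by apply/subsetP => x /setIdP[].
pose P := [set b in U_ R | (b \in Q_ R) == (a \in Q_ R)].
have cardP : #|P| = #|Q_ R|.
  rewrite /P; have [aQ|naQ] := boolP (a \in Q_ R).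
    apply: eq_card => b; rewrite inE eqb_id andbC.
    by case: (boolP (b \in Q_ R)) => //= /(subsetP QU).
  transitivity #|U_ R :\: Q_ R|.
    by apply: eq_card => b; rewrite !inE eqbF_neg andbC.
  by rewrite cardsDS // (card_units_squares he hpsi) // mul2n -addnn addnK.
transitivity (\sum_(b in U_ R)
    (if (b \in Q_ R) == (a \in Q_ R) then 2%:Z * #|ST_det R n b|%:Z else 0)).
  rewrite -big_mkcondr /= (eq_bigl [in P]) => [|b]; last by rewrite [b \in P]inE.
  rewrite (eq_bigr (fun=> 2%:Z * #|ST_det R n a|%:Z)) => [|b]; last first.
    by move=> /setIdP[bU /eqP ba]; rewrite (card_ST_det_class bU aU ba).
  rewrite sumr_const cardP (card_units_squares he hpsi) //.
  by rewrite -mulr_natr !PoszM; ring.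
have -> : (if a \in Q_ R then S_ R n psi else - S_ R n psi) =
    (if a \in Q_ R then 1 else -1) * S_ R n psi.
  by case: ifP; rewrite ?mul1r ?mulN1r.
rewrite card_IST /S_ (big_morph Posz PoszD (erefl 0%:Z)) mulr_sumr -big_split /=.
apply: eq_bigr => b; rewrite inE => ub.
rewrite (quadratic_char_residue he hpsi) //.
by case: (b \in Q_ R); case: (a \in Q_ R) => /=; ring.
Qed.

Lemma S_odd : odd n -> S_ R n psi = 0.
Proof.
move=> n_odd; have [u uU nu] := exists_nonsquare he hpsi two_neq0.
have U1 : 1 \in U_ R by rewrite inE unitr1.
have Q1 : 1 \in Q_ R by rewrite inE U1; apply/existsP; exists 1; rewrite expr1n.
have uu : u \is a GRing.unit by move: uU; rewrite inE.
have := card_ST_det_formula U1; have := card_ST_det_formula uU.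
rewrite Q1 (negPf nu).
(* For odd [n], [u ^+ n] is [u] times a unit square, so scaling by [u] matches determinant 1 with
   the class of [u]. The two formulas then give [S = - S]. *)
have -> : #|ST_det R n u| = #|ST_det R n 1|.
  rewrite -(@card_ST_det_scale R n u 1) // mulr1 -(odd_double_half n) n_odd.
  by rewrite exprS -mul2n mulnC exprM [u * _]mulrC card_ST_det_sqr ?unitrX.
move=> -> /addrI /eqP; rewrite eq_sym -addr_eq0 -mulr2n Num.Theory.mulrn_eq0 /=.
by move/eqP.
Qed.

End Counting.

Theorem theorem3p10 (q n e : nat)
    (hq : exists p k : nat, [/\ prime p, (0 < k)%N & q = (p ^ k)%N])
    (hqodd : odd q) (hn : (0 < n)%N)
    (R : finComUnitRingType) (hR : chain_ring R)
    (gamma : R) (hgamma : maximal_ideal (principal_ideal gamma))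
    (he : nilpotency_index gamma e)
    (F : finFieldType) (hF : #|F| = q)
    (psi : {rmorphism R -> F}) (hpsi : residue_map gamma psi) :
  (forall a : R, a \in U_ R ->
     (a \in Q_ R ->
        (#|ST_det R n a|)%:R =
          ((#|IST R n|)%:R + (S_ R n psi)%:~R) / ((q - 1) * q ^ (e - 1))%:R
          :> rat) /\
     (a \notin Q_ R ->
        (#|ST_det R n a|)%:R =
          ((#|IST R n|)%:R - (S_ R n psi)%:~R) / ((q - 1) * q ^ (e - 1))%:R
          :> rat)) /\
  (odd n ->
     S_ R n psi = 0 /\
     forall a : R, a \in U_ R ->
       (#|ST_det R n a|)%:R =
         (#|IST R n|)%:R / ((q - 1) * q ^ (e - 1))%:R :> rat).
Proof.
have [p [k [p_pr _ qE]]] := hq.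
have two_neq0 : 2%:R != 0 :> F.
  by apply: (@odd_card_two_neq0 F p k) => //; rewrite hF.
have cardU := card_units he hpsi; rewrite hF in cardU.
have U_neq0 : #|U_ R|%:R != 0 :> rat.
  rewrite Num.Theory.pnatr_eq0 -lt0n; apply/card_gt0P; exists 1.
  by rewrite inE unitr1.
(* The integer identity is transported to [rat], where [#|U_ R|] is nonzero and can be divided
   out. *)
have formula a (aU : a \in U_ R) : #|ST_det R n a|%:R =
    (#|IST R n|%:R + (if a \in Q_ R then S_ R n psi else - S_ R n psi)%:~R)
      / #|U_ R|%:R :> rat.
  apply: (mulIf U_neq0); rewrite divfK // -natrM.
  have := card_ST_det_formula hn he hpsi two_neq0 aU.
  by move/(congr1 (fun z : int => z%:~R : rat)); rewrite rmorphD.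
rewrite -cardU; split=> [a aU|n_odd].
  split=> [aQ|/negPf aQ]; rewrite formula // aQ //.
  by rewrite rmorphN.
have S0 := S_odd hn he hpsi two_neq0 n_odd.
split=> // a aU; rewrite formula // S0 oppr0 if_same.
by rewrite addr0.
Qed.
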